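(* Let $G\le S_n$ be a transitive permutation group of degree $n$. Then $r(G)=n-1$ if and only if $\mathrm{cr}(G)=n-1$; and if $\mathrm{cr}(G)\neq n-1$, then $r(G)=n$.
   Context: $S_n$ is the symmetric group on $\{1,\dots,n\}$, acting on the right (the image of $i$ under $\pi$ is $i\pi$), with the Hamming distance $d(\pi,\sigma)=|\{i : i\pi\neq i\sigma\}|$. For a nonempty subset $C\subseteq S_n$, the remoteness of $C$ is $r(C)=\min_{v\in S_n}\max_{c\in C} d(v,c)$ and the covering radius of $C$ is $\mathrm{cr}(C)=\max_{v\in S_n}\min_{c\in C} d(v,c)$. *)

(* Defs.v *)
From mathcomp Require Import all_boot all_fingroup.

Set Implicit Arguments.
Unset Strict Implicit.
Unset Printing Implicit Defensive.

(* The points are 'I_n = {0, ..., n-1}.  Permutations act on the right: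
   (s * t)%g x = t (s x), and s x is the image of x under s. *)
Definition hamming (n : nat) (s t : 'S_n) : nat := #|[set i | s i != t i]|.

Lemma hamming_le (n : nat) (s t : 'S_n) : hamming s t <= n.
Proof. by rewrite -[leqRHS]card_ord max_card. Qed.

(* For nonempty C both minima range over a nonempty set of values that are all
   <= n (hamming_le), so the seed n of minn does not affect the result. *)
Definition remoteness (n : nat) (C : {set 'S_n}) : nat :=
  \big[minn/n]_(v : 'S_n) \max_(c in C) hamming v c.

Definition covering_radius (n : nat) (C : {set 'S_n}) : nat :=
  \max_(v : 'S_n) \big[minn/n]_(c in C) hamming v c.

(* Main.v *)
Require Import Defs.
From mathcomp Require Import all_boot all_order all_fingroup.

(** The proof rests on a counting argument.  Fix a permutation [v].  In a
    transitive group [G] of degree [n], exactly [#|G| / n] elements send a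
    given point [i] to a given point, here [v i]; summing over the [n] points,
    the total number of agreements between [v] and the elements of [G] is
    [#|G|].  So the average distance from [v] to [G] is [n - 1]
    ([sum_hamming_trans]).

    Distances are integers bounded by [n], which leaves two cases.  Either all
    elements of [G] are at distance [n - 1] from [v], and then the nearest and
    the farthest element are both at distance [n - 1]; or the distances lie on
    both sides of the average, and then the farthest one is exactly [n]
    ([max_hamming_trans]) while the nearest one is less than [n - 1]
    ([min_hamming_trans]).

    Hence the remoteness is [n - 1] or [n], the covering radius is at most
    [n - 1], and each equals [n - 1] exactly when the first case occurs for
    some [v] (call such a [v] equidistant from [G]).  This common criterion
    gives both assertions. *)

(** Equality in a termwise comparison of sums forces equality of all terms. *)
Lemma sum_eq_bound_le {T : finType} {A : {set T}} {f : T -> nat} {m} :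
    \sum_(c in A) f c = #|A| * m -> (forall c, c \in A -> f c <= m) ->
  forall c, c \in A -> f c = m.
Proof.
move=> sumf le_f c Ac.
have [_] : \sum_(c in A) f c <= \sum_(c in A) m
             ?= iff [forall c in A, f c == m].
  by apply: leqif_sum => i Ai; split; first exact: le_f.
by rewrite sumf sum_nat_const eqxx => /esym/forall_inP/(_ c Ac)/eqP.
Qed.

Lemma sum_eq_bound_ge {T : finType} {A : {set T}} {f : T -> nat} {m} :
    \sum_(c in A) f c = #|A| * m -> (forall c, c \in A -> m <= f c) ->
  forall c, c \in A -> f c = m.
Proof.
move=> sumf ge_f c Ac.
have [_] : \sum_(c in A) m <= \sum_(c in A) f c
             ?= iff [forall c in A, m == f c].
  by apply: leqif_sum => i Ai; split; first exact: ge_f.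
by rewrite sumf sum_nat_const eqxx => /esym/forall_inP/(_ c Ac)/eqP.
Qed.

(** [minn] is convertible to the generic minimum [Order.min] on [nat], so the
    bounds known for the latter apply as they stand. *)
Lemma bigminn_geP {I : finType} {x m : nat} {P : pred I} {F : I -> nat} :
  reflect (m <= x /\ forall i, P i -> m <= F i)
          (m <= \big[minn/x]_(i | P i) F i).
Proof. exact: (Order.TotalTheory.bigmin_geP x m P F). Qed.

Lemma bigminn_le {I : finType} {x : nat} (j : I) {P : pred I} {F : I -> nat} :
  P j -> \big[minn/x]_(i | P i) F i <= F j.
Proof. exact: (@Order.TotalTheory.bigmin_le_cond _ nat). Qed.

(** The elements sending [x] to [y] form a coset of the stabiliser of [x]. *)
Lemma card_amove_trans {gT : finGroupType} {T : finType}
    {to : {action gT &-> T}} {G : {group gT}} (x y : T) :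
  [transitive G, on [set: T] | to] -> #|T| * #|amove to G x y| = #|G|.
Proof.
move=> trG; have /orbitP[a Ga <-] : y \in orbit to G x.
  by rewrite (atransP trG) ?inE.
rewrite amove_act ?subsetT // card_rcoset -(card_orbit_stab to G x).
by rewrite (atransP trG) ?inE // cardsT.
Qed.

(** Transitivity on a set requires the set to be the orbit of one of its
    points. *)
Lemma degree_gt0 {n} {G : {group 'S_n}} :
  [transitive G, on [set: 'I_n] | 'P] -> 0 < n.
Proof. by case/imsetP=> i _ _; apply: leq_ltn_trans (ltn_ord i). Qed.

Lemma hamming_agree {n} (s t : 'S_n) :
  #|[set i | t i == s i]| + hamming s t = n.
Proof.
rewrite /hamming (_ : [set i | s i != t i] = ~: [set i | t i == s i]).
  by rewrite cardsC card_ord.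
by apply/setP=> i; rewrite !inE eq_sym.
Qed.

Lemma sum_agree_trans {n} {G : {group 'S_n}} (v : 'S_n) :
    [transitive G, on [set: 'I_n] | 'P] ->
  \sum_(c in G) #|[set i | c i == v i]| = #|G|.
Proof.
move=> trG; apply/eqP; rewrite -(eqn_pmul2l (degree_gt0 trG)); apply/eqP.
have -> : \sum_(c in G) #|[set i | c i == v i]|
          = \sum_i #|amove 'P G i (v i)|.
  (* double counting of the pairs (c, i) with c i = v i *)
  under eq_bigr => c _ do rewrite -sum1dep_card big_mkcond /=.
  rewrite exchange_big; apply: eq_bigr => i _.
  by rewrite -big_mkcondr sum1dep_card; apply: eq_card => c; rewrite !inE.
rewrite big_distrr /= (eq_bigr (fun=> #|G|)) => [|i _].
  by rewrite sum_nat_const card_ord.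
by rewrite -[RHS](card_amove_trans i (v i) trG) card_ord.
Qed.

Lemma sum_hamming_trans {n} {G : {group 'S_n}} (v : 'S_n) :
    [transitive G, on [set: 'I_n] | 'P] ->
  \sum_(c in G) hamming v c = #|G| * (n - 1).
Proof.
move=> trG; rewrite mulnBr muln1 -sum_nat_const.
rewrite -[X in _ - X](sum_agree_trans v trG).
rewrite [X in _ = X - _](eq_bigr _ (fun c _ => esym (hamming_agree v c))).
by rewrite big_split addKn.
Qed.

Definition equidistant {n} (G : {set 'S_n}) (v : 'S_n) : bool :=
  [forall c in G, hamming v c == n - 1].

(** If no element were at distance [n], all distances would be at most their
    average [n - 1], hence all equal to it. *)
Lemma max_hamming_trans {n} {G : {group 'S_n}} (v : 'S_n) :
    [transitive G, on [set: 'I_n] | 'P] ->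
  \max_(c in G) hamming v c = if equidistant G v then n - 1 else n.
Proof.
move=> trG; have n_gt0 := degree_gt0 trG.
have [/forall_inP eqv | /negP neqv] := ifP.
  apply/eqP; rewrite eqn_leq; apply/andP; split.
    by apply/bigmax_leqP => c /eqv/eqP->.
  by rewrite -(eqP (eqv _ (group1 G))) leq_bigmax_cond.
apply/eqP; rewrite eqn_leq; apply/andP; split.
  by apply/bigmax_leqP => c _; apply: hamming_le.
rewrite leqNgt; apply/negP => lt_max; apply: neqv.
apply/forall_inP => c Gc; apply/eqP.
apply: sum_eq_bound_le (sum_hamming_trans v trG) _ c Gc => c Gc.
rewrite subn1 -ltnS prednK //.
by apply: leq_ltn_trans lt_max; rewrite leq_bigmax_cond.
Qed.

(** Distances that are all at least their average are all equal to it. *)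
Lemma min_hamming_trans {n} {G : {group 'S_n}} (v : 'S_n) :
    [transitive G, on [set: 'I_n] | 'P] ->
  (n - 1 <= \big[minn/n]_(c in G) hamming v c) = equidistant G v.
Proof.
move=> trG; apply/bigminn_geP/forall_inP=> [[_ ge_v] c Gc | eqv].
  exact/eqP/(sum_eq_bound_ge (sum_hamming_trans v trG)).
by split=> [|c /eqv/eqP->]; first exact: leq_subr.
Qed.

Lemma min_hamming_trans_le {n} {G : {group 'S_n}} (v : 'S_n) :
    [transitive G, on [set: 'I_n] | 'P] ->
  \big[minn/n]_(c in G) hamming v c <= n - 1.
Proof.
move=> trG; have [/forall_inP eqv | neqv] := boolP (equidistant G v).
  by rewrite -(eqP (eqv _ (group1 G))) bigminn_le.
by apply: ltnW; rewrite ltnNge (min_hamming_trans v trG).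
Qed.

Lemma remoteness_trans {n} {G : {group 'S_n}} :
    [transitive G, on [set: 'I_n] | 'P] ->
  remoteness G = if [exists v, equidistant G v] then n - 1 else n.
Proof.
move=> trG; rewrite /remoteness.
under eq_bigr => v _ do rewrite (max_hamming_trans v trG).
apply/eqP; rewrite eqn_leq; apply/andP; split.
  have [/existsP[v eqv] | _] := ifP.
    by apply: leq_trans (bigminn_le v isT) _; rewrite eqv.
  by apply: leq_trans (bigminn_le 1%g isT) _; case: ifP; rewrite ?leq_subr.
apply/bigminn_geP; split=> [|v _]; first by case: ifP; rewrite ?leq_subr.
case: ifP => [_ | /existsPn noeq]; first by case: ifP; rewrite ?leq_subr.
by rewrite (negPf (noeq v)).
Qed.

Lemma covering_radius_trans {n} {G : {group 'S_n}} :
    [transitive G, on [set: 'I_n] | 'P] ->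
  (covering_radius G == n - 1) = [exists v, equidistant G v].
Proof.
move=> trG; rewrite /covering_radius eqn_leq.
have -> /= : \max_(v : 'S_n) \big[minn/n]_(c in G) hamming v c <= n - 1.
  by apply/bigmax_leqP => v _; apply: min_hamming_trans_le trG.
apply/idP/existsP=> [|[v eqv]]; last first.
  by apply: (bigmax_sup v); rewrite ?min_hamming_trans.
have [|v ->] := @eq_bigmax _ (fun v => \big[minn/n]_(c in G) hamming v c).
  by apply/card_gt0P; exists 1%g.
by exists v; rewrite -(min_hamming_trans v trG).
Qed.

(* n = 0 is excluded by the transitivity hypothesis: an action on the empty
   set has no orbit. *)
Theorem proposition12 (n : nat) (G : {group 'S_n})
    (trG : [transitive G, on [set: 'I_n] | 'P]) :
  (remoteness G = n - 1 <-> covering_radius G = n - 1) /\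
  (covering_radius G <> n - 1 -> remoteness G = n).
Proof.
rewrite (remoteness_trans trG) -(covering_radius_trans trG).
have neq_n : n <> n - 1.
  by move=> eq_n; have := degree_gt0 trG; rewrite -ltn_predL -subn1 -eq_n ltnn.
by case: eqP.
Qed.
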